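(* There exist absolute constants $C,c>0$ and a function $p:\mathbb N\to[0,1]$ with $p(n)\to0$ as $n\to\infty$ such that the following holds. Let $n,d$ satisfy $n\ge C\,d\ln(2d)$. Let $\mathbf X\in\mathbb R^{n\times d}$ have i.i.d. $N(0,1)$ entries, and let $\mathbf X'\in\mathbb R^{n\times d}$ be obtained by choosing, independently of $\mathbf X$, indices $\boldsymbol\gamma_1,\dots,\boldsymbol\gamma_n$ i.i.d. uniform in $[n]$ and setting the $i$-th row of $\mathbf X'$ to be the $\boldsymbol\gamma_i$-th row of $\mathbf X$. Then with probability at least $1-p(n)$, the column span of $\mathbf X'$ is $(c\,n,c)$-spread.
   Context: A linear subspace $V\subseteq\mathbb R^n$ is $(m,\rho)$-spread if for every $v\in V$ and every $S\subseteq[n]$ with $|S|\ge n-m$ one has $\|v_S\|\ge\rho\|v\|$, where $v_S$ is the restriction of $v$ to coordinates in $S$. *)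

(* Defs.v *)
From HB Require Import structures.
From mathcomp Require Import all_boot all_order all_algebra.
From mathcomp Require Import all_classical all_reals all_analysis.
Set Implicit Arguments. Unset Strict Implicit. Unset Printing Implicit Defensive.
Import Order.TTheory GRing.Theory Num.Theory.
Local Open Scope classical_set_scope.
Local Open Scope ring_scope.

Section Defs.
Variable R : realType.

Definition restr_norm (n : nat) (S : {set 'I_n}) (v : 'cV[R]_n) : R :=
  Num.sqrt (\sum_(i in S) v i 0 ^+ 2).

Definition vnorm (n : nat) (v : 'cV[R]_n) : R := restr_norm [set: 'I_n]%SET v.

Definition spread (n : nat) (V : set 'cV[R]_n) (m rho : R) : Prop :=
  forall v, V v -> forall S : {set 'I_n}, n%:R - m <= #|S|%:R ->
    rho * vnorm v <= restr_norm S v.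

Definition colspan (n d : nat) (X : 'M[R]_(n, d)) : set 'cV[R]_n :=
  [set X *m a | a in [set: 'cV[R]_d]].

(* Expectation of a nonnegative functional F of a sequence of reals g,
   when the coordinates g 0, ..., g (k-1) are i.i.d. standard Gaussian
   (N(0,1) = normal_prob 0 1), computed as an iterated integral
   (the remaining coordinates are set to 0 and never used below). *)
Fixpoint gauss_exp (k : nat) (F : (nat -> R) -> \bar R) : \bar R :=
  match k with
  | 0 => F (fun _ => 0)
  | k'.+1 => (\int[normal_prob (0:R) 1]_x
               gauss_exp k' (fun g => F (fun i => if i == k' then x else g i)))%E
  end.

(* Matrix X in R^{n x d} read from the Gaussian coordinates:
   X i j = g (i * d + j), so the n*d entries are the first n*d coordinates. *)
Definition gmat (n d : nat) (g : nat -> R) : 'M[R]_(n, d) :=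
  \matrix_(i < n, j < d) g (i * d + j)%N.

Definition resample (n d : nat) (X : 'M[R]_(n, d)) (gam : {ffun 'I_n -> 'I_n})
  : 'M[R]_(n, d) := \matrix_(i < n, j < d) X (gam i) j.

Definition prob_spread (n d : nat) (c : R) : \bar R :=
  (((n ^ n)%:R)^-1%:E *
   \sum_(gam : {ffun 'I_n -> 'I_n})
     gauss_exp (n * d)
       (fun g => (\1_[set g' | spread (colspan (resample (gmat n d g') gam))
                                    (c * n%:R) c] g)%:E))%E.

End Defs.

(* Main.v *)
Require Import Defs.
From HB Require Import structures.
From mathcomp Require Import all_boot all_order all_algebra.
From mathcomp Require Import all_classical all_reals all_analysis.
From mathcomp Require Import measurable_realfun normal_distribution ring lra.
Import Order.TTheory GRing.Theory Num.Theory.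
Local Open Scope classical_set_scope.
Local Open Scope ring_scope.

(**
  Fix the indices [gam] and write [Y a] for the resampled matrix applied to [a].
  Two exponential-moment bounds over the finite net of integer vectors [z] with
  [|z|^2 <= D d], which has at most [exp ((D + 2) d)] points, give the theorem.

  - Upper bound: [|Y z|^2 = sum_i N_i <x_i, z>^2], where [N_i] is the
    multiplicity of [i].  With high probability all [N_i] are at most
    [L = 2 ln n], so the exponential moment of order about [1 / L] is finite and
    [|Y z|^2 <= 6 n D d] fails for each [z] with probability at most [exp (- n / L)].
    This beats the net because [d ln n] is small compared to [n] as soon as
    [n >= C d ln (2 d)].
  - Lower bound: with high probability [gam] has at least [n / 8] distinct
    values, so every large set [S] of rows still contains [n / 16] independent
    Gaussian rows, and [|(Y z)_S|^2] is at least a constant times [n D d] except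
    with probability [exp (- 4 n + n)], which beats the [2 ^ n] sets and the net.

  Rounding an arbitrary vector to the net costs at most [d] in squared norm,
  which the upper bound makes negligible against the lower bound.  All the
  Gaussian expectations involved are those of [exp (- sum_i c_i <x_i, z>^2)] and
  are computed exactly, one coordinate at a time.
*)

(** * Gaussian integrals in one variable and iterated expectations *)

Section GaussianIntegral.
Variable R : realType.
Local Notation mu := (@lebesgue_measure R).
Local Notation gauss := (@normal_prob R 0 1).

(** The Radon-Nikodym derivative of the normal law agrees almost everywhere with [normal_pdf], which
    turns Gaussian integrals into Lebesgue integrals. *)
Lemma ge0_integral_normal_prob (m s : R) (f : R -> \bar R) :
  (forall x, 0 <= f x)%E -> measurable_fun setT f ->
  (\int[normal_prob m s]_x f x = \int[mu]_x (f x * (normal_pdf m s x)%:E))%E.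
Proof.
move=> f0 mf.
have dom := normal_prob_dominates m s.
rewrite -(Radon_Nikodym_SigmaFinite.change_of_variables dom)//.
apply: ae_eq_integral => //.
- apply: emeasurable_funM => //.
  by apply: (measurable_int mu); exact: Radon_Nikodym_SigmaFinite.f_integrable.
- apply: emeasurable_funM => //; apply/measurable_EFinP.
  exact: measurable_normal_pdf.
- apply: ae_eqe_mul2l => /=; apply: integral_ae_eq => //=.
  + exact: Radon_Nikodym_SigmaFinite.f_integrable.
  + by apply/measurable_EFinP; exact: measurable_normal_pdf.
  + by move=> E _ mE; rewrite -Radon_Nikodym_SigmaFinite.f_integral.
Qed.

(** Completing the square: the product is a multiple of a normal density of variance [v^-1], where
    [v = 1 + 2 c t^2], so its integral can be read off. The sign of [c] is free as long as [v] is
    positive. *)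
Lemma expR_sqr_normal_pdf (c s t x : R) : 0 < 1 + 2 * c * t ^+ 2 ->
  expR (- c * (s + t * x) ^+ 2) * normal_pdf 0 1 x =
  expR (- c * s ^+ 2 / (1 + 2 * c * t ^+ 2)) / Num.sqrt (1 + 2 * c * t ^+ 2) *
  normal_pdf (- 2 * c * s * t / (1 + 2 * c * t ^+ 2))
             (Num.sqrt (1 + 2 * c * t ^+ 2))^-1 x.
Proof.
set v := 1 + _ => v0.
have r0 : 0 < Num.sqrt v by rewrite sqrtr_gt0.
have r2 : Num.sqrt v ^+ 2 = v by rewrite sqr_sqrtr// ltW.
rewrite !normal_pdfE ?oner_eq0 ?invr_eq0 ?gt_eqF// /normal_peak /normal_fun.
rewrite exprVn r2 expr1n mul1r subr0.
have -> : v^-1 * pi *+ 2 = (pi *+ 2) * v^-1 by rewrite -mulrnAr mulrC.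
rewrite sqrtrM; last by rewrite mulrn_wge0// pi_ge0.
rewrite invfM sqrtrV ?ltW// invrK.
rewrite mulrCA -expRD.
rewrite [RHS](_ : _ = (Num.sqrt (pi *+ 2))^-1 *
  (expR (- c * s ^+ 2 / v) * expR (- (x - - 2 * c * s * t / v) ^+ 2 / (v^-1 *+ 2)))); last first.
  set A := expR _; set B := expR _; set p := (Num.sqrt (pi *+ 2))^-1.
  by field; rewrite gt_eqF.
rewrite -expRD; congr (_ * expR _).
rewrite /v in v0 *.
field.
by rewrite gt_eqF.
Qed.

Lemma integral_expR_sqr (c s t : R) : 0 < 1 + 2 * c * t ^+ 2 ->
  (\int[gauss]_x (expR (- c * (s + t * x) ^+ 2))%:E =
   (expR (- c * s ^+ 2 / (1 + 2 * c * t ^+ 2)) / Num.sqrt (1 + 2 * c * t ^+ 2))%:E)%E.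
Proof.
move=> v0; rewrite ge0_integral_normal_prob//; last first.
- apply/measurable_EFinP; apply: measurableT_comp => //.
  apply: measurable_funM => //; apply: measurable_funX.
  by apply: measurable_funD => //; exact: measurable_funM.
under eq_integral do rewrite -EFinM expR_sqr_normal_pdf// EFinM.
rewrite ge0_integralZl//.
- by rewrite integral_normal_pdf mule1.
- by apply/measurable_EFinP; exact: measurable_normal_pdf.
- by move=> x _; rewrite lee_fin normal_pdf_ge0.
Qed.

(* No measurability is needed, the integral of a nonnegative function being a
   supremum over the simple functions below it.  This matters because the event
   [spread] is not known to be measurable. *)
Lemma le_integral_nomeas d (T : measurableType d)
    (nu : {measure set T -> \bar R}) (f g : T -> \bar R) :
  (forall x, f x <= g x)%E -> (\int[nu]_x f x <= \int[nu]_x g x)%E.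
Proof.
move=> fg; rewrite (integralE _ _ f) (integralE _ _ g).
have mono (h1 h2 : T -> \bar R) : (forall x, 0 <= h1 x)%E -> (forall x, h1 x <= h2 x)%E ->
  (\int[nu]_x h1 x <= \int[nu]_x h2 x)%E.
  move=> h10 h12; have h20 x : (0 <= h2 x)%E by exact: le_trans (h12 x).
  rewrite !ge0_integralTE//; apply: le_ereal_sup => _ [h hh <-].
  by exists h => // x; exact: le_trans (hh x) (h12 x).
apply: leeB; apply: mono => x //=.
- by rewrite !funeposE ge_max !le_max fg lexx orbT.
- by rewrite !funenegE ge_max !le_max leeN2 fg lexx orbT.
Qed.

(* [F] is integrable at each stage of the iterated integral, whose value is [v]:
   unlike [gauss_exp], this relation is additive in [F]. *)
Fixpoint has_gexp (k : nat) (F : (nat -> R) -> R) (v : R) : Prop :=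
  match k with
  | 0 => F (fun _ => 0) = v
  | k'.+1 => exists w : R -> R,
      [/\ forall x, has_gexp k' (fun g => F (fun i => if i == k' then x else g i)) (w x),
          gauss.-integrable setT (EFin \o w) &
          (\int[gauss]_x (w x)%:E = v%:E)%E]
  end.

Lemma le_gauss_exp k (F G : (nat -> R) -> \bar R) :
  (forall g, F g <= G g)%E -> (gauss_exp k F <= gauss_exp k G)%E.
Proof.
elim: k F G => [|k IH] F G FG /=; first exact: FG.
by apply: le_integral_nomeas => x; apply: IH => g; exact: FG.
Qed.

Lemma has_gexpE k F v : has_gexp k F v -> gauss_exp k (EFin \o F) = v%:E.
Proof.
elim: k F v => [|k IH] F v /=; first by move=> ->.
by move=> [w [Fw _ <-]]; apply: eq_integral => x _; exact: IH (Fw x).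
Qed.

Lemma has_gexp_cst k v : has_gexp k (fun=> v) v.
Proof.
elim: k => //= k IH; exists (fun=> v); split => //.
- exact: finite_measure_integrable_cst.
- rewrite integral_cst// [X in (_ * X)%E](_ : _ = 1%E) ?mule1//.
  exact: (@probability_setT _ _ _ gauss).
Qed.

Lemma has_gexpD k F G v w : has_gexp k F v -> has_gexp k G w ->
  has_gexp k (fun g => F g + G g) (v + w).
Proof.
elim: k F G v w => [|k IH] F G v w /=; first by move=> -> ->.
move=> [v' [Fv iv iv']] [w' [Gw iw iw']].
exists (fun x => v' x + w' x); split.
- by move=> x; exact: IH.
- by rewrite (_ : EFin \o _ = (EFin \o v') \+ (EFin \o w')); [exact: integrableD|exact/funext].
- under eq_integral do rewrite EFinD.
  by rewrite integralD//= iv' iw'.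
Qed.

Lemma has_gexpZ k F v a : has_gexp k F v -> has_gexp k (fun g => a * F g) (a * v).
Proof.
elim: k F v => [|k IH] F v /=; first by move=> ->.
move=> [v' [Fv iv iv']].
exists (fun x => a * v' x); split.
- by move=> x; exact: IH.
- by rewrite (_ : EFin \o _ = (fun x => a%:E * (EFin \o v') x)%E); [exact: integrableZl|exact/funext].
- under eq_integral do rewrite EFinM.
  by rewrite integralZl//= iv'.
Qed.

Lemma has_gexp_sum k (I : Type) (r : seq I) (P : pred I) F (v : I -> R) :
  (forall i, P i -> has_gexp k (F i) (v i)) ->
  has_gexp k (fun g => \sum_(i <- r | P i) F i g) (\sum_(i <- r | P i) v i).
Proof.
move=> Fv; elim: r => [|i r IH].
  have := has_gexp_cst k 0; congr (has_gexp k _ _); last by rewrite big_nil.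
  by apply/funext => g; rewrite big_nil.
rewrite big_cons; under eq_fun do rewrite big_cons.
by case: ifP => // Pi; apply: has_gexpD => //; exact: Fv.
Qed.

Lemma eq_has_gexp k F G v : (forall g, F g = G g) -> has_gexp k F v -> has_gexp k G v.
Proof. by move=> /funext ->. Qed.

End GaussianIntegral.

(** * Exponential moments of quadratic forms in Gaussian rows *)

Section GaussianRows.
Variable R : realType.
Local Notation gauss := (@normal_prob R 0 1).

Lemma integrable_expR_sqr (c s t : R) : 0 < 1 + 2 * c * t ^+ 2 ->
  gauss.-integrable setT (fun x => (expR (- c * (s + t * x) ^+ 2))%:E).
Proof.
move=> v0; apply/integrableP; split.
  apply/measurable_EFinP; apply: measurableT_comp => //.
  apply: measurable_funM => //; apply: measurable_funX.
  by apply: measurable_funD => //; exact: measurable_funM.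
under eq_integral do rewrite gee0_abs ?lee_fin ?expR_ge0//.
by rewrite integral_expR_sqr// ltry.
Qed.

(** Induction on [j]; the last coordinate is the outermost integral. The shift [s] is arbitrary so
    that it can absorb a coordinate already fixed: the inner value is again a Gaussian exponential,
    with [c / q] in place of [c]. *)
Lemma has_gexp_row (k : nat) (F : (nat -> R) -> R) (V c : R) (b : nat -> R) :
  (forall g g', (forall i, (i < k)%N -> g i = g' i) -> F g = F g') ->
  has_gexp R k F V ->
  forall j s, 0 < 1 + 2 * c * \sum_(l < j) b l ^+ 2 ->
  has_gexp R (k + j)
    (fun g => expR (- c * (s + \sum_(l < j) b l * g (k + l)%N) ^+ 2) * F g)
    (expR (- c * s ^+ 2 / (1 + 2 * c * \sum_(l < j) b l ^+ 2)) /
       Num.sqrt (1 + 2 * c * \sum_(l < j) b l ^+ 2) * V).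
Proof.
move=> depF FV; elim=> [|j IH] s.
  move=> _; rewrite addn0 !big_ord0 mulr0 addr0 sqrtr1 !divr1.
  apply: eq_has_gexp (has_gexpZ _ _ _ _ (expR (- c * s ^+ 2)) FV) => g.
  by rewrite big_ord0 addr0.
rewrite !big_ord_recr/=; set W := \sum_(l < j) b l ^+ 2; set t := b j => Wt0.
(* For negative [c], dropping the square [t ^+ 2] only increases the quantity. *)
have W0 : 0 < 1 + 2 * c * W.
  have W_ge0 : 0 <= W by apply: sumr_ge0 => i _; exact: sqr_ge0.
  have [c0|c0] := leP 0 c; first by rewrite ltr_pwDl// !mulr_ge0.
  apply: lt_le_trans Wt0 _; rewrite lerD2l ler_wnM2l//.
    by rewrite mulr_ge0_le0// ltW.
  by rewrite lerDl sqr_ge0.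
rewrite addnS /=.
set q := 1 + 2 * c * W in W0 *.
have qt : 1 + 2 * (c / q) * t ^+ 2 = (1 + 2 * c * (W + t ^+ 2)) / q.
  by rewrite /q in W0 *; field; rewrite gt_eqF.
have qt0 : 0 < 1 + 2 * (c / q) * t ^+ 2 by rewrite qt divr_gt0.
have sq0 : 0 < Num.sqrt q by rewrite sqrtr_gt0.
have wE x : expR (- c * (s + t * x) ^+ 2 / q) / Num.sqrt q * V =
    V / Num.sqrt q * expR (- (c / q) * (s + t * x) ^+ 2).
  rewrite (_ : - (c / q) * _ = - c * (s + t * x) ^+ 2 / q); last by ring.
  by ring.
exists (fun x => expR (- c * (s + t * x) ^+ 2 / q) / Num.sqrt q * V); split.
- move=> x; apply: eq_has_gexp (IH (s + t * x) W0) => g.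
  congr (expR (_ * _ ^+ 2) * _).
    rewrite big_ord_recr/= eqxx -addrA [t * x + _]addrC; congr (_ + (_ + _)).
    by apply: eq_bigr => l _; rewrite eqn_add2l ltn_eqF.
  by apply: depF => i ik; rewrite ltn_eqF// ltn_addr.
- rewrite (_ : EFin \o _ = (fun x =>
      (V / Num.sqrt q)%:E * (expR (- (c / q) * (s + t * x) ^+ 2))%:E)%E).
    by apply: integrableZl => //; exact: integrable_expR_sqr.
  by apply/funext => x /=; rewrite wE EFinM.
- under eq_integral do rewrite wE EFinM.
  rewrite integralZl//=; last exact: integrable_expR_sqr.
  rewrite integral_expR_sqr// -EFinM; congr EFin.
  rewrite qt; set Q := 1 + 2 * c * (W + t ^+ 2).
  have Q0 : 0 < Num.sqrt Q by rewrite sqrtr_gt0.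
  rewrite sqrtrM ?(ltW Wt0)// sqrtrV ?(ltW W0)//.
  have -> : - (c / q) * s ^+ 2 / (Q / q) = - c * s ^+ 2 / Q.
    by field; rewrite !gt_eqF.
  by field; rewrite !gt_eqF.
Qed.

(** Independence of the rows: the exponential of the earlier rows serves as the factor [F] of
    [has_gexp_row]. *)
Lemma has_gexp_rows (n d : nat) (c b : nat -> R) :
  (forall i, (i < n)%N -> 0 < 1 + 2 * c i * \sum_(l < d) b l ^+ 2) ->
  has_gexp R (n * d)
    (fun g => expR (- \sum_(i < n) c i * (\sum_(l < d) b l * g (i * d + l)%N) ^+ 2))
    (\prod_(i < n) (Num.sqrt (1 + 2 * c i * \sum_(l < d) b l ^+ 2))^-1).
Proof.
elim: n => [|n IH] c0.
  rewrite big_ord0; apply: eq_has_gexp (has_gexp_cst _ _ 1) => g.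
  by rewrite big_ord0 oppr0 expR0.
rewrite mulSnr big_ord_recr/= mulrC.
have /= := has_gexp_row _ _ _ (c n) b _ (IH _) d 0 (c0 _ (ltnSn n)).
rewrite expr0n mulr0 mul0r expR0 mul1r => H.
apply: eq_has_gexp (H _ _).
- move=> g; rewrite big_ord_recr/= add0r opprD expRD mulrC mulNr.
  by [].
- move=> g g' gg'; congr (expR (- _)); apply: eq_bigr => i _.
  congr (_ * _ ^+ 2); apply: eq_bigr => l _; rewrite gg'//.
  by rewrite (@leq_trans (i.+1 * d))// ?leq_mul2r ?ltn_ord ?orbT// mulSnr ltn_add2l.
- by move=> i ni; apply: c0; exact: ltnW.
Qed.

End GaussianRows.

(** * A net of integer vectors *)

Section Net.
Variable R : realType.

(** The subtracted term makes the induction close: the two new end terms are at most [2^-1 ^+ M.+1]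
    each, which is exactly the growth of the bound. *)
Lemma sum_expRN_sqr_le3 (M : nat) :
  \sum_(i < (M + M).+1) expR (- (i%:R - M%:R) ^+ 2) <= (3 - 2 * 2^-1 ^+ M : R).
Proof.
elim: M => [|M IH]; first by rewrite big_ord1 subrr expr0n oppr0 expR0 expr0; lra.
have expM : expR (- M.+1%:R ^+ 2) <= (2^-1 ^+ M.+1 : R).
  rewrite expRN exprVn lef_pV2 ?posrE ?expR_gt0 ?exprn_gt0//.
  rewrite (@le_trans _ _ (expR M.+1%:R))//.
    have -> : expR M.+1%:R = expR 1 ^+ M.+1 :> R by rewrite -expRM_natl mulr1.
    by apply: lerXn2r; rewrite ?nnegrE ?expR_ge0// (le_trans _ (expR_ge1Dx 1)).
  by rewrite ler_expR expr2 ler_peMl// ler1n.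
rewrite addnS addSn big_ord_recl big_ord_recr/=.
under eq_bigr => i _ do rewrite /bump/= add1n -!natr1 opprD addrACA subrr addr0.
rewrite sub0r sqrrN [X in X - M.+1%:R](_ : _ = M.+1%:R + M.+1%:R); last first.
  by rewrite -natrD /bump leq0n add1n addSn addnS.
rewrite addrK.
move: IH expM; rewrite (exprS 2^-1 M); lra.
Qed.

Definition sqnorm n (S : {set 'I_n}) (v : 'cV[R]_n) : R := \sum_(i in S) v i 0 ^+ 2.
Local Notation nrm2 v := (sqnorm _ [set: _]%SET v).

(** The index [i] stands for the integer [i - M], so a finite function type encodes the integer
    points of a cube. *)
Definition int_vec (M d : nat) (f : {ffun 'I_d -> 'I_(M + M).+1}) : 'cV[R]_d :=
  \col_j ((f j)%:R - M%:R).

Lemma sqn_ge0 n S (v : 'cV[R]_n) : 0 <= sqnorm n S v.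
Proof. by apply: sumr_ge0 => i _; exact: sqr_ge0. Qed.

Lemma sqnT n (v : 'cV[R]_n) : nrm2 v = \sum_i v i 0 ^+ 2.
Proof. by rewrite /sqnorm; apply: eq_bigl => i; rewrite inE. Qed.

Lemma sqn_le n (S T : {set 'I_n}) (v : 'cV[R]_n) : S \subset T -> sqnorm n S v <= sqnorm n T v.
Proof.
move=> ST; rewrite [leRHS](big_setID S)/= (finset.setIidPr ST) lerDl.
by apply: sumr_ge0 => i _; exact: sqr_ge0.
Qed.

Lemma sqnD n S (u v : 'cV[R]_n) : sqnorm n S (u + v) <= 2 * sqnorm n S u + 2 * sqnorm n S v.
Proof.
rewrite /sqnorm !mulr_sumr -big_split/=; apply: ler_sum => i _; rewrite mxE.
by have := sqr_ge0 (u i 0 - v i 0); rewrite sqrrB sqrrD; lra.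
Qed.

Lemma sqnZ n S t (v : 'cV[R]_n) : sqnorm n S (t *: v) = t ^+ 2 * sqnorm n S v.
Proof. by rewrite /sqnorm mulr_sumr; apply: eq_bigr => i _; rewrite mxE exprMn. Qed.

(** Each counted vector [z] has weight [exp (B - |z|^2) >= 1]. The total weight factorizes over the
    coordinates, each contributing at most [3 <= exp 2]. *)
Lemma card_grid_le (M d : nat) (B : R) :
  #|[pred f : {ffun 'I_d -> 'I_(M + M).+1} | nrm2 (int_vec M d f) <= B]|%:R <=
  expR (B + 2 * d%:R).
Proof.
rewrite -sum1_card natr_sum.
apply: (@le_trans _ _ (\sum_(f : {ffun 'I_d -> 'I_(M + M).+1})
    expR B * \prod_j expR (- ((f j)%:R - M%:R) ^+ 2))).
  rewrite [leRHS](bigID (fun f => nrm2 (int_vec M d f) <= B))/=.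
  rewrite -[leLHS]addr0 lerD//; last first.
    by apply: sumr_ge0 => f _; rewrite mulr_ge0 ?expR_ge0// prodr_ge0// => j _; exact: expR_ge0.
  apply: ler_sum => f fB.
  rewrite -expR_sum -expRD -[leLHS]expR0 ler_expR sumrN subr_ge0.
  apply: le_trans fB; rewrite sqnT.
  by rewrite le_eqVlt; apply/orP; left; apply/eqP/eq_bigr => j _; rewrite mxE.
rewrite -mulr_sumr expRD ler_wpM2l ?expR_ge0//.
rewrite -(bigA_distr_bigA (fun (j : 'I_d) (i : 'I_(M + M).+1) => expR (- (i%:R - M%:R) ^+ 2 : R))).
rewrite big_const_ord iter_mulr_1.
rewrite [2 * _]mulrC expRM_natl; apply: lerXn2r; rewrite ?nnegrE ?expR_ge0//.
  by apply: sumr_ge0 => i _; exact: expR_ge0.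
apply: le_trans (sum_expRN_sqr_le3 M) _.
apply: le_trans (expR_ge1Dx 2).
have : 0 <= 2^-1 ^+ M :> R by rewrite exprn_ge0.
lra.
Qed.

(* Rounding towards zero, so that the norm does not increase. *)
Lemma grid_round1 (M : nat) (x : R) : `|x| <= M%:R ->
  exists i : 'I_(M + M).+1,
    (x - (i%:R - M%:R)) ^+ 2 <= 1 /\ (i%:R - M%:R) ^+ 2 <= x ^+ 2 :> R.
Proof.
move=> xM.
have /andP[t1 t2] := truncn_itv (normr_ge0 x).
set t := Num.truncn `|x| in t1 t2.
have tM : (t <= M)%N by rewrite -(ler_nat R) (le_trans t1).
rewrite -natr1 in t2.
have t0 : 0 <= t%:R :> R by [].
have [x0|x0] := leP 0 x.
  rewrite ger0_norm// in t1 t2.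
  have iM : (M + t < (M + M).+1)%N by rewrite ltnS leq_add2l.
  exists (Ordinal iM) => /=; rewrite natrD addrAC subrr add0r.
  by split; nra.
rewrite ltr0_norm// in t1 t2.
have iM : (M - t < (M + M).+1)%N by rewrite ltnS (leq_trans (leq_subr _ _))// leq_addr.
exists (Ordinal iM) => /=; rewrite natrB//.
rewrite [_ - _ - _](_ : _ = - t%:R); last by ring.
by split; nra.
Qed.

Lemma grid_round (M d : nat) (a : 'cV[R]_d) : nrm2 a <= M%:R ^+ 2 ->
  exists f, nrm2 (a - int_vec M d f) <= d%:R /\ nrm2 (int_vec M d f) <= nrm2 a.
Proof.
move=> aM.
have aj j : `|a j 0| <= M%:R.
  rewrite -(@ler_pXn2r _ 2)// ?nnegrE// real_normK ?num_real//.
  apply: le_trans aM; rewrite sqnT (bigD1 j)//= lerDl.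
  by apply: sumr_ge0 => i _; exact: sqr_ge0.
pose h j := cid (grid_round1 _ _ (aj j)).
exists [ffun j => sval (h j)]; rewrite !sqnT; split.
  have -> : d%:R = \sum_(j < d) 1 :> R by rewrite sumr_const card_ord.
  apply: ler_sum => j _; rewrite !mxE ffunE.
  by case: (svalP (h j)).
apply: ler_sum => j _; rewrite !mxE ffunE.
by case: (svalP (h j)).
Qed.

End Net.

(** * From the net to all vectors, for a fixed matrix *)

Section Deterministic.
Variable R : realType.
Local Notation sqn := (sqnorm R _).
Local Notation nrm2 v := (sqn [set: _]%SET v).
Local Notation grid := (int_vec R).

(* If [s] is the supremum over the ball, rounding gives [s <= 2 T + 2 s / D]. *)
Lemma sqn_mulmx_net_le (n d M : nat) (Y : 'M[R]_(n, d)) (D T : R) :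
  (0 < d)%N -> 4 <= D -> D * d%:R <= M%:R ^+ 2 ->
  (forall f, nrm2 (grid M d f) <= D * d%:R -> nrm2 (Y *m grid M d f) <= T) ->
  forall a, nrm2 a <= D * d%:R -> nrm2 (Y *m a) <= 4 * T.
Proof.
move=> d0 D4 DM netT.
have d0' : 0 < d%:R :> R by rewrite ltr0n.
have D0 : 0 < D by apply: lt_le_trans D4.
pose A := [set nrm2 (Y *m a) | a in [set a : 'cV[R]_d | nrm2 a <= D * d%:R]].
have A0 : A !=set0.
  exists (nrm2 (Y *m 0)), 0 => //=.
  by rewrite sqnT big1 ?mulr_ge0 ?ltW// => i _; rewrite mxE expr0n.
(* A crude bound, so that [sup A] really is an upper bound of [A]. *)
have ubA : has_ubound A.
  exists (\sum_i (\sum_j `|Y i j| * M%:R) ^+ 2) => _ [a /= aD <-].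
  rewrite sqnT; apply: ler_sum => i _.
  rewrite -[leLHS]real_normK ?num_real// lerXn2r ?nnegrE ?normr_ge0//.
    by apply: sumr_ge0 => j _; rewrite mulr_ge0.
  rewrite mxE (le_trans (ler_norm_sum _ _ _))//; apply: ler_sum => j _.
  rewrite normrM ler_wpM2l// -(@ler_pXn2r _ 2)// ?nnegrE// real_normK ?num_real//.
  apply: le_trans (le_trans aD DM); rewrite sqnT (bigD1 j)//= lerDl.
  by apply: sumr_ge0 => l _; exact: sqr_ge0.
have supA a : nrm2 a <= D * d%:R -> nrm2 (Y *m a) <= sup A.
  by move=> aD; apply: ub_le_sup => //; exists a.
suff supT : sup A <= 4 * T by move=> a /supA /le_trans; apply.
suff : sup A <= 2 * T + sup A / 2 by lra.
apply: ge_sup => // _ [a /= aD <-].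
have [f [af fa]] := grid_round _ _ _ _ (le_trans aD DM).
rewrite -(subrKC (grid M d f) a) mulmxDr (le_trans (sqnD _ _ _ _ _))//.
rewrite lerD// ?ler_wpM2l ?netT ?(le_trans fa)//.
set e := a - _ in af *.
(* As [|e|^2 <= d], the vector [sqrt D e] lies in the ball, so
   [|Y e|^2 <= sup A / D <= sup A / 4]. *)
have := supA (Num.sqrt D *: e).
rewrite -scalemxAr !sqnZ sqr_sqrtr ?(ltW D0)// ler_pM2l// => /(_ af).
have := sqn_ge0 _ _ [set: 'I_n]%SET (Y *m e); nra.
Qed.

(** By homogeneity [|a|^2 = D d]. Rounding costs at most [4 K n d] in [|Y e|^2], which the size of
    [D] makes small against [kap n D d]; what remains, [kap n D d / 4], is compared with the upper
    bound [4 K n D d] on [|Y a|^2]. *)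
Lemma sqn_mulmx_net_spread (n d M : nat) (Y : 'M[R]_(n, d)) (D K kap : R)
    (good : pred {set 'I_n}) :
  (0 < d)%N -> 0 < K -> 0 < kap -> 4 <= D -> 16 * K / kap <= D ->
  D * d%:R <= M%:R ^+ 2 ->
  (forall f, nrm2 (grid M d f) <= D * d%:R ->
     nrm2 (Y *m grid M d f) <= K * n%:R * D * d%:R) ->
  (forall f S, good S -> D * d%:R / 4 <= nrm2 (grid M d f) <= D * d%:R ->
     kap * n%:R * D * d%:R <= sqn S (Y *m grid M d f)) ->
  forall a S, good S -> kap / (16 * K) * nrm2 (Y *m a) <= sqn S (Y *m a).
Proof.
move=> d0 K0 kap0 D4 DK DM netU netL a S gS.
have d0' : 0 < d%:R :> R by rewrite ltr0n.
have D0 : 0 < D by apply: lt_le_trans D4.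
have U := sqn_mulmx_net_le _ _ _ _ _ _ d0 D4 DM netU.
have [->|a0] := eqVneq a 0.
  by rewrite mulmx0 -(scale0r 0) !sqnZ expr0n !mul0r mulr0.
have na0 : 0 < nrm2 a.
  rewrite lt_neqAle sqn_ge0 andbT eq_sym; apply: contra a0.
  rewrite sqnT psumr_eq0 => [/allP aj|i _]; last exact: sqr_ge0.
  apply/eqP/matrixP => i j; rewrite ord1 mxE; apply/eqP.
  by have := aj i (mem_index_enum i); rewrite /= sqrf_eq0.
pose t := Num.sqrt (D * d%:R / nrm2 a).
have t2 : t ^+ 2 = D * d%:R / nrm2 a by rewrite sqr_sqrtr// divr_ge0 ?mulr_ge0 ?ltW.
have t20 : 0 < t ^+ 2 by rewrite t2 !mulr_gt0// invr_gt0.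
suff : kap / (16 * K) * nrm2 (Y *m (t *: a)) <= sqn S (Y *m (t *: a)).
  by rewrite -scalemxAr !sqnZ mulrCA ler_pM2l.
set b := t *: a.
have nb : nrm2 b = D * d%:R by rewrite sqnZ t2 divfK// gt_eqF.
have bD : nrm2 b <= D * d%:R by rewrite nb.
have [f [bf fb]] := grid_round _ _ _ _ (le_trans bD DM).
set z := grid M d f in bf fb; set e := b - z in bf.
have be : b = e + z by rewrite /e subrK.
have ze : z = b - e by rewrite be addrC addKr.
(* From [D d <= 2 d + 2 |z|^2] and [D >= 4]. *)
have nz : D * d%:R / 4 <= nrm2 z.
  have := sqnD R d [set: 'I_d]%SET e z; rewrite -be nb.
  have := ler_pM2r d0' 4 D; rewrite D4 => /idP; lra.
have Lz : kap * n%:R * D * d%:R <= sqn S (Y *m z) by apply: netL; rewrite // nz -nb.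
have Ue : nrm2 (Y *m e) <= 4 * K * n%:R * d%:R.
  have := U (Num.sqrt D *: e).
  rewrite -scalemxAr !sqnZ sqr_sqrtr ?(ltW D0)// ler_pM2l// => /(_ bf).
  rewrite (_ : 4 * _ = D * (4 * K * n%:R * d%:R)); last by ring.
  by rewrite ler_pM2l.
have Ub := U b bD.
have eS : sqn S (Y *m e) <= nrm2 (Y *m e) by apply: sqn_le; apply/fintype.subsetP => i; rewrite inE.
have ZS : sqn S (Y *m z) <= 2 * sqn S (Y *m b) + 2 * sqn S (Y *m e).
  rewrite ze mulmxBr -scaleN1r (le_trans (sqnD _ _ _ _ _))// sqnZ sqrrN expr1n mul1r.
  by [].
have nd0 : 0 <= n%:R * d%:R :> R by rewrite mulr_ge0.
have DK' : 16 * K * (n%:R * d%:R) <= kap * D * (n%:R * d%:R).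
  by rewrite ler_wpM2r// -ler_pdivrMl// mulrC.
apply: (@le_trans _ _ (kap * D * (n%:R * d%:R) / 4)); last by lra.
apply: (le_trans (ler_wpM2l _ Ub)); first by rewrite divr_ge0 ?mulr_ge0// ltW.
rewrite le_eqVlt; apply/orP; left; apply/eqP.
by field; rewrite gt_eqF.
Qed.

End Deterministic.

(** * Expectations for fixed indices *)

Section FixedResampling.
Variable R : realType.
Local Notation sqn := (sqnorm R _).
Local Notation nrm2 v := (sqn [set: _]%SET v).
Local Notation grid := (int_vec R).

Lemma has_gexp_gmat (n d : nat) (c : 'I_n -> R) (z : 'cV[R]_d) :
  (forall i, 0 < 1 + 2 * c i * nrm2 z) ->
  has_gexp R (n * d)
    (fun g => expR (- \sum_i c i * (gmat n d g *m z) i 0 ^+ 2))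
    (\prod_i (Num.sqrt (1 + 2 * c i * nrm2 z))^-1).
Proof.
move=> c0.
(* Extension by 0 beyond the ordinals, since [has_gexp_rows] takes families indexed by [nat]. *)
pose b l := oapp (fun i : 'I_d => z i 0) 0 (insub l).
pose c' l := oapp c 0 (insub l).
have bE (i : 'I_d) : b i = z i 0 by rewrite /b valK.
have cE (i : 'I_n) : c' i = c i by rewrite /c' valK.
have zE : nrm2 z = \sum_(l < d) b l ^+ 2.
  by rewrite sqnT; apply: eq_bigr => i _; rewrite bE.
have c'0 i : (i < n)%N -> 0 < 1 + 2 * c' i * \sum_(l < d) b l ^+ 2.
  by move=> ilt; rewrite -zE (cE (Ordinal ilt)).
have := has_gexp_rows R n d c' b c'0.
rewrite -zE; under [X in has_gexp _ _ _ X -> _]eq_bigr do rewrite cE.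
apply: eq_has_gexp => g; congr (expR (- _)); apply: eq_bigr => i _.
rewrite cE; congr (_ * _ ^+ 2); rewrite mxE; apply: eq_bigr => l _.
by rewrite bE mxE mulrC.
Qed.

Definition multiplicity n (gam : {ffun 'I_n -> 'I_n}) (i : 'I_n) : nat := #|[pred j | gam j == i]|.

Lemma sum_mult n (gam : {ffun 'I_n -> 'I_n}) (F : 'I_n -> R) :
  \sum_j F (gam j) = \sum_i (multiplicity n gam i)%:R * F i.
Proof.
rewrite (partition_big gam predT)//=; apply: eq_bigr => i _.
rewrite (eq_bigr (fun=> F i)) => [|j /eqP->//].
by rewrite sumr_const mulr_natl.
Qed.

Lemma resampleE n d (X : 'M[R]_(n, d)) (gam : {ffun 'I_n -> 'I_n}) (z : 'cV[R]_d) j :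
  (resample X gam *m z) j 0 = (X *m z) (gam j) 0.
Proof. by rewrite !mxE; apply: eq_bigr => l _; rewrite mxE. Qed.

Lemma sqn_resample n d (X : 'M[R]_(n, d)) (gam : {ffun 'I_n -> 'I_n}) (z : 'cV[R]_d) :
  nrm2 (resample X gam *m z) = \sum_i (multiplicity n gam i)%:R * (X *m z) i 0 ^+ 2.
Proof.
by rewrite sqnT -sum_mult; apply: eq_bigr => j _; rewrite resampleE.
Qed.

(** Each value attained on [S] keeps one preimage in [S]; the other terms of its fibre are
    nonnegative. *)
Lemma sqn_resample_ge n d (X : 'M[R]_(n, d)) (gam : {ffun 'I_n -> 'I_n}) (z : 'cV[R]_d) (S : {set 'I_n}) :
  sqn (gam @: S)%SET (X *m z) <= sqn S (resample X gam *m z).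
Proof.
rewrite [leRHS](partition_big_imset gam)/=; apply: ler_sum => i /imsetP[j jS ->].
rewrite (bigD1 j)/=; last by rewrite jS eqxx.
rewrite resampleE lerDl; apply: sumr_ge0 => l _; exact: sqr_ge0.
Qed.

(** Amounts to [exp (- 2 y) <= 1 - y], which follows from [(1 - y) (1 + 2 y) >= 1] on this range. *)
Lemma invr_sqrt_le_expR (y : R) : 0 <= y <= 2^-1 -> (Num.sqrt (1 - y))^-1 <= expR y.
Proof.
move=> /andP[y0 y1].
have q0 : 0 < 1 - y by lra.
rewrite -[leRHS]invrK -expRN lef_pV2 ?posrE ?sqrtr_gt0 ?expR_gt0//.
rewrite -[leLHS]ger0_norm ?expR_ge0// -sqrtr_sqr ler_wsqrtr//.
rewrite -expRM_natl mulrN expRN -[leLHS]div1r ler_pdivrMr ?expR_gt0//.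
apply: (@le_trans _ _ ((1 - y) * (1 + 2 * y))); first by nra.
by rewrite ler_wpM2l ?(ltW q0)// expR_ge1Dx.
Qed.

(** The multiplicities sum to [n], so the bounds on the factors multiply to an exponential
    independent of [gam]. The last hypothesis keeps each factor in the range of
    [invr_sqrt_le_expR]. *)
Lemma prod_mult_le n gam (lam B s : R) : 0 <= lam -> 0 <= s <= B ->
  (forall i, 4 * lam * B * (multiplicity n gam i)%:R <= 1) ->
  \prod_i (Num.sqrt (1 + 2 * (- lam * (multiplicity n gam i)%:R) * s))^-1 <=
  expR (2 * lam * B * n%:R).
Proof.
move=> lam0 /andP[s0 sB] lamB.
have -> : 2 * lam * B * n%:R = \sum_i (multiplicity n gam i)%:R * (2 * lam * B).
  by rewrite -sum_mult sumr_const card_ord mulr_natr.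
rewrite expR_sum; apply: ler_prod => i _; rewrite invr_ge0 sqrtr_ge0/=.
have -> : 1 + 2 * (- lam * (multiplicity n gam i)%:R) * s = 1 - 2 * (lam * (multiplicity n gam i)%:R) * s.
  by ring.
have ls : lam * (multiplicity n gam i)%:R * s <= lam * (multiplicity n gam i)%:R * B.
  by rewrite ler_wpM2l// mulr_ge0.
have ls0 : 0 <= lam * (multiplicity n gam i)%:R * s by rewrite !mulr_ge0.
have := lamB i => lamBi.
apply: (le_trans (invr_sqrt_le_expR _ _)); first by lra.
by rewrite ler_expR; lra.
Qed.

(** Each factor indexed by [T] is at most [exp (- m)]; the others equal 1. *)
Lemma prod_indic_le n (T : {set 'I_n}) (lam s m a : R) : 0 <= lam -> 0 <= s ->
  expR (2 * m) <= 2 * lam * s -> 0 <= m -> a <= #|T|%:R ->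
  \prod_i (Num.sqrt (1 + 2 * (if i \in T then lam else 0) * s))^-1 <= expR (- m * a).
Proof.
move=> lam0 s0 ms m0 aT.
rewrite (bigID (mem T))/= [X in _ * X]big1 => [|i /negbTE ->]; last first.
  by rewrite mulr0 mul0r addr0 sqrtr1 invr1.
rewrite mulr1.
apply: (@le_trans _ _ (\prod_(i in T) expR (- m))).
  apply: ler_prod => i ->; rewrite invr_ge0 sqrtr_ge0/=.
  rewrite expRN lef_pV2 ?posrE ?sqrtr_gt0 ?expR_gt0//; last first.
    by have := expR_gt0 (2 * m); lra.
  rewrite -[leLHS]ger0_norm ?expR_ge0// -sqrtr_sqr ler_wsqrtr//.
  by rewrite -expRM_natl (le_trans ms)// lerDr.
rewrite prodr_const -expRM_natl ler_expR mulrC !mulNr lerN2 ler_wpM2l//.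
Qed.

End FixedResampling.

(** * Probability of spread for fixed, well-behaved indices *)

Section FixedIndices.
Variable R : realType.
Local Notation sqn := (sqnorm R _).
Local Notation nrm2 v := (sqn [set: _]%SET v).
Local Notation grid := (int_vec R).
Local Notation mult := (multiplicity _).

(* [net_radius = 16 K / kap] as required by [sqn_mulmx_net_spread], for [K = 6]
   and [kap = (2 * expR 128)^-1], the constants of [gauss_exp_spread].
   Then [spread_const ^+ 2 <= kap / (16 * K)]. *)
Definition net_radius : R := 192 * expR 128.
Definition spread_const : R := expR (- 64) / 16.
Local Notation D := net_radius.
Local Notation c := spread_const.

Lemma spread_sqn n (V : set 'cV[R]_n) (m r : R) : 0 <= r ->
  (forall v, V v -> forall S : {set 'I_n}, n%:R - m <= #|S|%:R ->
     r ^+ 2 * nrm2 v <= sqn S v) ->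
  spread V m r.
Proof.
move=> r0 H v Vv S mS; rewrite /vnorm /restr_norm.
rewrite -[r]ger0_norm// -sqrtr_sqr -sqrtrM ?sqr_ge0//.
by rewrite ler_wsqrtr// H.
Qed.

(** Each row outside [S] accounts for at most one value missing from the image of [S]. *)
Lemma card_imset_setC n (gam : {ffun 'I_n -> 'I_n}) (S : {set 'I_n}) :
  (#|gam @: [set: 'I_n]%SET| <= #|gam @: S| + (n - #|S|))%N.
Proof.
have -> : (n - #|S| = #|~: S|)%N by rewrite [RHS]cardsCs finset.setCK card_ord.
rewrite -(finset.setUCr S) imsetU (leq_trans (leq_card_setU _ _))// leq_add2l.
exact: leq_imset_card.
Qed.

(** Chernoff and union bounds written as one pointwise inequality: every failure of a net inequality
    makes some term of [Phi] at least 1. Only the explicit function [1 - Phi] is integrated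
    exactly. *)
Lemma gauss_exp_spread n d (gam : {ffun 'I_n -> 'I_n}) (L : R) :
  (0 < d)%N -> 0 < L -> (forall i, (mult gam i)%:R <= L) ->
  n%:R / 8 <= #|gam @: [set: 'I_n]%SET|%:R :> R ->
  (D + 2) * d%:R * (2 * L) <= n%:R -> (D + 2) * d%:R <= n%:R ->
  ((1 - (expR (- n%:R / (2 * L)) + expR (- n%:R)))%:E <=
   gauss_exp (n * d) (fun g =>
     (\1_[set g' | spread (colspan (resample (gmat n d g') gam)) (c * n%:R) c] g)%:E))%E.
Proof.
move=> d0 L0 multL im8 dL dn.
have d0' : 0 < d%:R :> R by rewrite ltr0n.
have e0 : 0 < expR 128 :> R by exact: expR_gt0.
have e1 : 1 <= expR 128 :> R by rewrite -expR0 ler_expR.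
have D0 : 0 < D by rewrite mulr_gt0.
have D4 : 4 <= D by rewrite /net_radius; lra.
pose M := (Num.truncn (D * d%:R)).+1.
have DM : D * d%:R <= M%:R ^+ 2.
  have := truncnS_gt (D * d%:R); rewrite -/M => /ltW/le_trans; apply.
  by rewrite expr2 ler_peMl// ler1n.
pose F := {ffun 'I_d -> 'I_(M + M).+1}.
pose P (f : F) := nrm2 (grid M d f) <= D * d%:R.
pose good (S : {set 'I_n}) := n%:R / 16 <= #|gam @: S|%:R :> R.
(* The largest order with [4 lam D d L <= 1], as [prod_mult_le] demands. *)
pose lam := (4 * L * (D * d%:R))^-1.
have lam0 : 0 < lam by rewrite invr_gt0 !mulr_gt0.
(* Chosen so that [2 lam2 (D d / 4) = exp 128], giving a factor [exp (- 64)] per distinct row; with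
   [n / 16] such rows this is [exp (- 4 n)]. The threshold [kap n D d] times [lam2] is [n]. *)
pose lam2 := 2 * expR 128 / (D * d%:R).
have lam20 : 0 < lam2 by rewrite divr_gt0 ?mulr_gt0.
pose kap : R := (2 * expR 128)^-1.
have kap0 : 0 < kap by rewrite invr_gt0 mulr_gt0.
pose c1 i := - lam * (mult gam i)%:R.
pose c2 (S : {set 'I_n}) i := if i \in (gam @: S)%SET then lam2 else 0.
pose q (cc : 'I_n -> R) f g := expR (- \sum_i cc i * (gmat n d g *m grid M d f) i 0 ^+ 2).
pose v (cc : 'I_n -> R) f := \prod_i (Num.sqrt (1 + 2 * cc i * nrm2 (grid M d f)))^-1.
pose U1 := expR (- (lam * (6 * n%:R * D * d%:R))).
(* [1 - Phi] is a lower bound for the indicator of [spread]. *)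
pose Phi g := \sum_(f : F | P f) U1 * q c1 f g +
  \sum_(f : F | P f && (D * d%:R / 4 <= nrm2 (grid M d f)))
    \sum_(S | good S) expR n%:R * q (c2 S) f g.
pose w := \sum_(f : F | P f) U1 * v c1 f +
  \sum_(f : F | P f && (D * d%:R / 4 <= nrm2 (grid M d f)))
    \sum_(S | good S) expR n%:R * v (c2 S) f.
have q0 cc f g : 0 <= q cc f g by exact: expR_ge0.
have multD i : 4 * lam * (D * d%:R) * (mult gam i)%:R <= 1.
  have -> : 4 * lam * (D * d%:R) = L^-1 by rewrite /lam; field; rewrite !gt_eqF.
  by rewrite mulrC ler_pdivrMr// mul1r.
have c1_pos f i : P f -> 0 < 1 + 2 * c1 i * nrm2 (grid M d f).
  rewrite /P /c1 => Pf.
  have m0 : 0 <= lam * (mult gam i)%:R by rewrite mulr_ge0// ltW.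
  have := ler_wpM2l m0 Pf; have := multD i; lra.
have c2_pos S f i : 0 < 1 + 2 * c2 S i * nrm2 (grid M d f).
  rewrite ltr_wpDr// !mulr_ge0 ?sqn_ge0// /c2.
  by case: ifP => // _; exact: ltW.
have PhiE : has_gexp R (n * d) Phi w.
  apply: has_gexpD.
    apply: has_gexp_sum => f Pf; apply: has_gexpZ; apply: has_gexp_gmat => i.
    exact: c1_pos.
  apply: has_gexp_sum => f _; apply: has_gexp_sum => S _.
  by apply: has_gexpZ; exact: has_gexp_gmat.
have cardP x : 0 <= x -> \sum_(f : F | P f) x <= expR ((D + 2) * d%:R) * x.
  move=> x0; rewrite (eq_bigl (mem [pred f : F | P f]))// sumr_const -[leLHS]mulr_natl.
  by rewrite ler_wpM2r// mulrDl; exact: card_grid_le.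
have w1 : \sum_(f : F | P f) U1 * v c1 f <= expR (- n%:R / (2 * L)).
  (* The threshold 6 gives exponent [- 3 n / (2 L)] and the moment gives [n / (2 L)]; the net then
     costs another [n / (2 L)]. *)
  apply: (@le_trans _ _ (\sum_(f : F | P f) expR (- n%:R / L))).
    apply: ler_sum => f Pf.
    have s0B : 0 <= nrm2 (grid M d f) <= D * d%:R by rewrite sqn_ge0.
    apply: (@le_trans _ _ (U1 * expR (2 * lam * (D * d%:R) * n%:R))).
      rewrite ler_wpM2l ?expR_ge0//.
      exact: prod_mult_le (ltW lam0) s0B multD.
    rewrite -expRD ler_expR le_eqVlt; apply/orP; left; apply/eqP.
    by rewrite /lam; field; rewrite !gt_eqF.
  apply: (le_trans (cardP _ (expR_ge0 _))).
  rewrite -expRD ler_expR.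
  have : (D + 2) * d%:R <= n%:R / (2 * L) by rewrite ler_pdivlMr// mulr_gt0.
  have -> : - n%:R / L = - (2 * (n%:R / (2 * L))) by field; rewrite gt_eqF.
  by rewrite mulNr; lra.
have w2 : \sum_(f : F | P f && (D * d%:R / 4 <= nrm2 (grid M d f)))
    \sum_(S | good S) expR n%:R * v (c2 S) f <= expR (- n%:R).
  apply: (@le_trans _ _ (\sum_(f : F | P f) \sum_(S : {set 'I_n}) expR (- 3 * n%:R))).
    rewrite [leRHS](bigID (fun f => D * d%:R / 4 <= nrm2 (grid M d f)))/=.
    rewrite -[leLHS]addr0 lerD//; last first.
      by apply: sumr_ge0 => f _; apply: sumr_ge0 => S _; exact: expR_ge0.
    apply: ler_sum => f /andP[_ Df].
    rewrite [leRHS](bigID good)/= -[leLHS]addr0 lerD//; last first.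
      by apply: sumr_ge0 => S _; exact: expR_ge0.
    apply: ler_sum => S gS.
    have lams : expR (2 * 64) <= 2 * lam2 * nrm2 (grid M d f).
      have -> : 2 * 64 = 128 :> R by ring.
      apply: (@le_trans _ _ (2 * lam2 * (D * d%:R / 4))).
        rewrite le_eqVlt; apply/orP; left; apply/eqP; rewrite /lam2.
        by field; rewrite !gt_eqF.
      by rewrite ler_wpM2l// mulr_ge0// ltW.
    have := prod_indic_le _ _ (gam @: S)%SET lam2 (nrm2 (grid M d f)) 64 _
      (ltW lam20) (sqn_ge0 _ _ _ _) lams _ gS.
    move=> /(_ ltac:(lra)) H.
    apply: le_trans (ler_wpM2l (expR_ge0 _) H) _.
    by rewrite -expRD ler_expR; lra.
  apply: (le_trans (cardP _ _)); first by apply: sumr_ge0 => S _; exact: expR_ge0.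
  rewrite sumr_const -[X in _ * X <= _]mulr_natl.
  have -> : #|{set 'I_n}|%:R = 2 ^+ n :> R.
    by rewrite -cardsT -powersetT card_powerset cardsT card_ord natrX.
  have e2 : 2 ^+ n <= expR n%:R :> R.
    rewrite -[n%:R]mulr1 expRM_natl lerXn2r ?nnegrE ?expR_ge0//.
    by rewrite (le_trans _ (expR_ge1Dx 1)).
  apply: (@le_trans _ _ (expR n%:R * (expR n%:R * expR (- 3 * n%:R)))).
    apply: ler_pM; rewrite ?ler_expR ?ler_wpM2r ?expR_ge0//.
  by rewrite -!expRD ler_expR; lra.
have PhiE' : has_gexp R (n * d) (fun g => 1 + -1 * Phi g) (1 + -1 * w).
  by apply: has_gexpD; [exact: has_gexp_cst|exact: has_gexpZ].
apply: (@le_trans _ _ (1 + -1 * w)%:E).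
  by rewrite lee_fin; have := lerD w1 w2; rewrite -/w; lra.
rewrite -(has_gexpE _ _ _ _ PhiE'); apply: le_gauss_exp => g /=.
rewrite lee_fin indicE.
have Phi1 : 0 <= \sum_(f : F | P f) U1 * q c1 f g.
  by apply: sumr_ge0 => f _; rewrite mulr_ge0// expR_ge0.
have Phi2' f : 0 <= \sum_(S | good S) expR n%:R * q (c2 S) f g.
  by apply: sumr_ge0 => S _; rewrite mulr_ge0// expR_ge0.
have Phi2 : 0 <= \sum_(f : F | P f && (D * d%:R / 4 <= nrm2 (grid M d f)))
    \sum_(S | good S) expR n%:R * q (c2 S) f g.
  by apply: sumr_ge0.
case: (boolP (g \in _)) => [_|/negP gn]; first by rewrite /Phi /=; lra.
suff : 1 <= Phi g by rewrite /=; lra.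
rewrite leNgt; apply/negP => Phi_lt1; apply: gn; rewrite inE /=.
set Y := resample _ _.
have netU f : P f -> nrm2 (Y *m grid M d f) <= 6 * n%:R * D * d%:R.
  move=> Pf; rewrite leNgt; apply/negP => lt; move: Phi_lt1; apply/negP.
  rewrite -leNgt /Phi -[leLHS]addr0 lerD// (bigD1 f)//= -[leLHS]addr0 lerD//; last first.
    by apply: sumr_ge0 => f' _; rewrite mulr_ge0// expR_ge0.
  rewrite -expRD -[leLHS]expR0 ler_expR.
  have -> : - \sum_i c1 i * (gmat n d g *m grid M d f) i 0 ^+ 2 = lam * nrm2 (Y *m grid M d f).
    rewrite sqn_resample mulr_sumr -sumrN; apply: eq_bigr => i _.
    by rewrite /c1; ring.
  by rewrite addrC -mulrBr mulr_ge0 ?(ltW lam0)// subr_ge0 ltW.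
have netL f S : good S -> D * d%:R / 4 <= nrm2 (grid M d f) <= D * d%:R ->
    kap * n%:R * D * d%:R <= sqn S (Y *m grid M d f).
  move=> gS /andP[Df Pf]; apply: le_trans (sqn_resample_ge _ _ _ _ _ _ _).
  rewrite leNgt; apply/negP => lt; move: Phi_lt1; apply/negP.
  rewrite -leNgt /Phi -[leLHS]add0r lerD// (bigD1 f)/=; last by rewrite /P Pf Df.
  rewrite -[leLHS]addr0 lerD//; last by apply: sumr_ge0.
  rewrite (bigD1 S)//= -[leLHS]addr0 lerD//; last first.
    by apply: sumr_ge0 => S' _; rewrite mulr_ge0// expR_ge0.
  rewrite -expRD -[leLHS]expR0 ler_expR.
  have -> : \sum_i c2 S i * (gmat n d g *m grid M d f) i 0 ^+ 2 =
      lam2 * sqn (gam @: S)%SET (gmat n d g *m grid M d f).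
    rewrite /sqnorm mulr_sumr [RHS]big_mkcond/=; apply: eq_bigr => i _.
    by rewrite /c2; case: ifP => //; rewrite mul0r.
  have -> : n%:R = lam2 * (kap * n%:R * D * d%:R).
    by rewrite /lam2 /kap; field; rewrite !gt_eqF.
  by rewrite -mulrBr mulr_ge0 ?(ltW lam20)// subr_ge0 ltW.
have c0 : 0 < c by rewrite divr_gt0 ?expR_gt0.
apply: spread_sqn; first exact: ltW.
move=> _ [a _ <-] S nS.
(* Since [c <= 1 / 16], at least [n / 8 - n / 16] distinct values survive on [S]. *)
have gS : good S.
  have := card_imset_setC n gam S; rewrite -(ler_nat R) natrD natrB; last first.
    by rewrite (leq_trans (max_card _))// card_ord.
  have c16 : c * n%:R <= n%:R / 16.
    rewrite mulrC ler_wpM2l// ler_pdivrMr// mulVf// -expR0 ler_expR; lra.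
  by rewrite /good; lra.
have K6 : 16 * 6 / kap <= D by rewrite /kap /net_radius invrK; lra.
have := sqn_mulmx_net_spread R n d M Y D 6 kap good d0 _ kap0 D4 K6 DM netU netL a S gS.
move=> /(_ ltac:(lra)); apply: le_trans.
rewrite ler_wpM2r ?sqn_ge0//.
have -> : c ^+ 2 = (expR 128)^-1 / 256.
  rewrite /spread_const expr_div_n -expRM_natl -expRN; congr (expR _ / _); lra.
rewrite /kap invfM -mulrA mulrCA; rewrite ler_wpM2l ?invr_ge0 ?(ltW e0)//; lra.
Qed.

End FixedIndices.

(** * Counting index functions *)

Section Counting.
Variable R : realType.
Local Notation mult := (multiplicity _).
Local Notation D := (net_radius R).
Local Notation c := (spread_const R).

(** The exponential moment of a binomial variable: the sum factorizes over [j] and is at most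
    [(n + e)^n <= n^n exp e]. *)
Lemma sum_expR_mult n (i : 'I_n) :
  \sum_(gam : {ffun 'I_n -> 'I_n}) expR (mult gam i)%:R <= (n ^ n)%:R * expR (expR 1) :> R.
Proof.
have n0 : 0 < n%:R :> R by rewrite ltr0n (leq_ltn_trans _ (ltn_ord i)).
have -> : \sum_(gam : {ffun 'I_n -> 'I_n}) expR (mult gam i)%:R =
    \sum_(gam : {ffun 'I_n -> 'I_n}) \prod_j (if gam j == i then expR 1 else 1) :> R.
  apply: eq_bigr => gam _; rewrite -big_mkcond/= prodr_const -expRM_natl mulr1.
  by [].
rewrite -(bigA_distr_bigA (fun _ k => if k == i then expR 1 else 1 : R)).
rewrite big_const_ord iter_mulr_1 (bigD1 i)//= eqxx.
apply: (@le_trans _ _ ((n%:R * expR (expR 1 / n%:R)) ^+ n)).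
  rewrite lerXn2r ?nnegrE//.
  - by rewrite addr_ge0 ?expR_ge0// sumr_ge0// => k _; case: ifP => // _; exact: expR_ge0.
  apply: (@le_trans _ _ (expR 1 + n%:R)).
    rewrite lerD2l (eq_bigr (fun=> 1)) => [|k /negbTE->//].
    by rewrite sumr_const ler_nat (leq_trans (max_card _))// card_ord.
  rewrite -ler_pdivrMl//; apply: le_trans (expR_ge1Dx _).
  by rewrite le_eqVlt; apply/orP; left; apply/eqP; field; rewrite gt_eqF.
rewrite exprMn natrX ler_wpM2l ?exprn_ge0//.
by rewrite -expRM_natl mulrC divfK// gt_eqF.
Qed.

(** Markov's inequality for the exponential of each multiplicity, then a union bound over [i]. *)
Lemma card_mult_gt n (L : R) :
  \sum_(gam : {ffun 'I_n -> 'I_n}) (~~ [forall i, (mult gam i)%:R <= L])%:R <=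
  (n ^ n)%:R * (n%:R * expR (expR 1) * expR (- L)).
Proof.
have -> : (n ^ n)%:R * (n%:R * expR (expR 1) * expR (- L)) =
    expR (- L) * \sum_(i < n) ((n ^ n)%:R * expR (expR 1)) :> R.
  by rewrite sumr_const card_ord -[X in _ = _ * X]mulr_natl; ring.
apply: (@le_trans _ _ (expR (- L) * \sum_(i < n)
    \sum_(gam : {ffun 'I_n -> 'I_n}) expR (mult gam i)%:R)); last first.
  by rewrite ler_wpM2l ?expR_ge0//; apply: ler_sum => i _; exact: sum_expR_mult.
rewrite exchange_big/= mulr_sumr; apply: ler_sum => gam _.
rewrite negb_forall; case: existsP => [[i]|_]; last first.
  by rewrite mulr_ge0 ?expR_ge0// sumr_ge0// => i _; exact: expR_ge0.
rewrite -ltNge => iL; rewrite (bigD1 i)//= mulrDr -[leLHS]addr0 lerD//.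
  by rewrite -expRD -[leLHS]expR0 ler_expR; lra.
by rewrite mulr_ge0 ?expR_ge0// sumr_ge0// => k _; exact: expR_ge0.
Qed.

(** Union bound over the possible images [T]: there are at most [2^n], each allowing at most
    [(n / 8)^n] functions. *)
Lemma card_small_imset n :
  \sum_(gam : {ffun 'I_n -> 'I_n}) (#|gam @: [set: 'I_n]%SET|%:R < n%:R / 8 :> R)%:R <=
  (n ^ n)%:R * 4^-1 ^+ n :> R.
Proof.
apply: (@le_trans _ _ (\sum_(gam : {ffun 'I_n -> 'I_n})
    \sum_(T : {set 'I_n} | #|T|%:R < n%:R / 8 :> R) (gam \in ffun_on (mem T))%:R)).
  apply: ler_sum => gam _; have [lt8|] := ltP; last by rewrite sumr_ge0.
  rewrite (bigD1 (gam @: [set: 'I_n])%SET)//= (_ : gam \in _); last first.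
    by apply/ffun_onP => j; apply: imset_f; rewrite inE.
  by rewrite lerDl sumr_ge0.
rewrite exchange_big/=.
apply: (@le_trans _ _ (\sum_(T : {set 'I_n}) (n%:R / 8) ^+ n)).
  rewrite [leRHS](bigID (fun T : {set 'I_n} => #|T|%:R < n%:R / 8 :> R))/=.
  rewrite -[leLHS]addr0 lerD//; last by rewrite sumr_ge0// => T _; rewrite exprn_ge0// divr_ge0.
  apply: ler_sum => T T8; rewrite -natr_sum.
  have -> : (\sum_(gam : {ffun 'I_n -> 'I_n}) (gam \in ffun_on (mem T)) =
      #|ffun_on (mem T) : {pred {ffun 'I_n -> 'I_n}}|)%N.
    by rewrite -sum1_card [RHS]big_mkcond; apply: eq_bigr => g _; case: (g \in _).
  rewrite card_ffun_on card_ord natrX lerXn2r ?nnegrE ?divr_ge0//.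
  exact: ltW.
rewrite sumr_const -[leLHS]mulr_natl -cardsT -powersetT card_powerset cardsT card_ord.
rewrite !natrX -!exprMn le_eqVlt; apply/orP; left; apply/eqP; congr (_ ^+ _).
by field.
Qed.

End Counting.

(** * Choice of the constants *)

Section Final.
Variable R : realType.
Local Notation D := (net_radius R).

Lemma ln_le_2sqrt (y : R) : 0 < y -> ln y <= 2 * Num.sqrt y.
Proof.
move=> y0; have s0 : 0 < Num.sqrt y by rewrite sqrtr_gt0.
rewrite -[in leLHS](sqr_sqrtr (ltW y0)) lnXn// -[leLHS]mulr_natl ler_wpM2l//.
exact/ltW/ln_sublinear.
Qed.

(** With [y = n / d], [ln n] is at most [ln (2 d) + ln y]. The hypothesis controls the first term;
    for the second, [ln y <= 2 sqrt y] and [y >= 16 B^2] suffice, also when [n] is far larger than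
    [d]. *)
Lemma dim_mul_ln_le (B : R) (n d : nat) : 1 <= B -> (0 < d)%N -> (0 < n)%N ->
  32 * B ^+ 2 * d%:R * ln (2 * d%:R) <= n%:R ->
  B * d%:R * ln n%:R <= n%:R /\ B * d%:R <= n%:R.
Proof.
move=> B1 d0 n0 Hn.
have d1 : 1 <= d%:R :> R by rewrite ler1n.
have d0' : 0 < d%:R :> R by rewrite ltr0n.
have n0' : 0 < n%:R :> R by rewrite ltr0n.
have ln2 : 1 / 2 <= ln 2 :> R.
  have := @le_ln1Dx R (- (1 / 2)) ltac:(lra).
  rewrite (_ : 1 + - (1 / 2) = 2^-1); last by field.
  by rewrite lnV ?posrE//; lra.
have ln2d : ln 2 <= ln (2 * d%:R) :> R by rewrite ler_ln ?posrE ?mulr_gt0//; lra.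
pose y : R := n%:R / d%:R.
have y0 : 0 < y by rewrite divr_gt0.
have nE : n%:R = y * d%:R by rewrite /y divfK// gt_eqF.
have yB : 16 * B ^+ 2 <= y.
  rewrite ler_pdivlMr//; apply: le_trans Hn.
  have B2 : 0 <= 32 * B ^+ 2 * d%:R by rewrite mulr_ge0 ?(ltW d0')// mulr_ge0 ?sqr_ge0.
  have := ler_wpM2l B2 (le_trans ln2 ln2d); lra.
split; last by rewrite nE ler_wpM2r ?ltW//; nra.
have lnn : ln n%:R <= ln (2 * d%:R) + 2 * Num.sqrt y.
  rewrite nE lnM ?posrE// addrC lerD ?ln_le_2sqrt//.
  by rewrite ler_ln ?posrE ?mulr_gt0//; lra.
have sy : 4 * B * Num.sqrt y <= y.
  rewrite -[leRHS](sqr_sqrtr (ltW y0)) expr2 ler_wpM2r ?sqrtr_ge0//.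
  rewrite -[leLHS]ger0_norm; last by lra.
  rewrite -sqrtr_sqr ler_wsqrtr// exprMn; lra.
have Bd0 : 0 <= B * d%:R by rewrite mulr_ge0; lra.
apply: le_trans (ler_wpM2l Bd0 lnn) _.
have h1 : 2 * (B * d%:R * ln (2 * d%:R)) <= n%:R.
  apply: le_trans Hn.
  rewrite (_ : 2 * _ = 2 * B * (d%:R * ln (2 * d%:R))); last by ring.
  rewrite (_ : 32 * _ * _ * _ = 32 * B ^+ 2 * (d%:R * ln (2 * d%:R))); last by ring.
  rewrite ler_wpM2r ?mulr_ge0 ?(ltW d0')//; last by nra.
  by lra.
have h2 : 4 * B * Num.sqrt y * d%:R <= n%:R by rewrite nE ler_wpM2r// ltW.
by rewrite mulrDr; lra.
Qed.

Lemma expRN_le_inv (x : R) : 0 < x -> expR (- x) <= x^-1.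
Proof.
move=> x0; rewrite expRN lef_pV2 ?posrE ?expR_gt0//.
by apply: le_trans (expR_ge1Dx x); rewrite lerDr.
Qed.

(** The coefficients of the four failure terms are 8, 1, [exp e] and 1; the factor 2 pays for
    passing from [sqrt n] to [sqrt (n + 1)], which is positive for every [n]. *)
Definition fail_const : R := 2 * (10 + expR (expR 1)).

(** For [L = 2 ln n], the multiplicity term [n exp (- L)] is [1 / n], while [exp (- n / (2 L)) <= 4
    ln n / n <= 8 / sqrt n]. *)
Lemma fail_prob_le (n : nat) : (2 <= n)%N ->
  expR (- n%:R / (2 * (2 * ln n%:R))) + expR (- n%:R) +
  (n%:R * expR (expR 1) * expR (- (2 * ln n%:R)) + 4^-1 ^+ n) <=
  fail_const / Num.sqrt n.+1%:R.
Proof.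
move=> n2.
have n2' : 2 <= n%:R :> R by rewrite (ler_nat _ 2).
have n0 : 0 < n%:R :> R by lra.
pose s : R := Num.sqrt n%:R.
have s1 : 1 <= s by rewrite /s -[leLHS]sqrtr1 ler_wsqrtr//; lra.
have s0 : 0 < s by lra.
have s2 : s ^+ 2 = n%:R by rewrite sqr_sqrtr// ltW.
have lnn0 : 0 < ln n%:R :> R by apply: ln_gt0; lra.
have is0 : 0 < s^-1 by rewrite invr_gt0.
have is1 : s^-1 <= 1 by rewrite invf_le1.
have ns : n%:R^-1 <= s^-1 by rewrite -s2 -exprVn expr2 ler_piMl// ltW.
have t1 : expR (- n%:R / (2 * (2 * ln n%:R))) <= 8 * s^-1.
  rewrite mulNr; apply: (le_trans (expRN_le_inv _ _)); first by rewrite !mulr_gt0// invr_gt0 !mulr_gt0.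
  rewrite invf_div ler_pdivrMr// (_ : 8 * s^-1 * _ = 8 * s); last by rewrite -s2; field; rewrite gt_eqF.
  by have := ln_le_2sqrt _ n0; rewrite -/s; lra.
have t2 : expR (- n%:R) <= s^-1 by apply: le_trans ns; exact: expRN_le_inv.
have t3 : n%:R * expR (expR 1) * expR (- (2 * ln n%:R)) <= expR (expR 1) * s^-1.
  rewrite expRN mulrC expRM_natl lnK ?posrE// expr2 invfM.
  rewrite [leLHS](_ : _ = expR (expR 1) * n%:R^-1); last by field; rewrite gt_eqF.
  by rewrite ler_wpM2l ?expR_ge0.
have t4 : 4^-1 ^+ n <= s^-1 :> R.
  apply: le_trans ns; rewrite exprVn lef_pV2 ?posrE ?exprn_gt0//.
  by rewrite -natrX ler_nat ltnW// ltn_expl.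
have st : s^-1 <= 2 / Num.sqrt n.+1%:R.
  rewrite ler_pdivlMr ?sqrtr_gt0// ler_pdivrMl//.
  rewrite (_ : s * 2 = Num.sqrt (n%:R * 4)); last first.
    rewrite sqrtrM ?ltW// (_ : 4 = 2 ^+ 2); last by ring.
    by rewrite sqrtr_sqr ger0_norm.
  by rewrite ler_wsqrtr// -natr1; lra.
apply: (@le_trans _ _ ((10 + expR (expR 1)) * s^-1)); first last.
  rewrite [leRHS](_ : _ = (10 + expR (expR 1)) * (2 / Num.sqrt n.+1%:R)).
    by rewrite ler_wpM2l// addr_ge0 ?expR_ge0.
  by rewrite /fail_const mulrAC mulrC mulrA.
rewrite (_ : _ * s^-1 = 8 * s^-1 + s^-1 + (expR (expR 1) * s^-1 + s^-1)); last by ring.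
by rewrite !lerD.
Qed.

Lemma fail_cvg : (Num.min 1 (fail_const / Num.sqrt n.+1%:R) @[n --> \oo] --> 0).
Proof.
have f0 : 0 < fail_const by rewrite mulr_gt0// addr_gt0 ?expR_gt0.
apply/cvgrPdist_le => e e0; near=> n.
rewrite sub0r normrN ger0_norm; last by rewrite le_min ler01 divr_ge0 ?sqrtr_ge0// ltW.
rewrite ge_min; apply/orP; right.
rewrite ler_pdivrMr ?sqrtr_gt0// -ler_pdivrMl// mulrC.
rewrite -[leLHS]ger0_norm ?divr_ge0 ?(ltW f0) ?(ltW e0)// -sqrtr_sqr ler_wsqrtr//.
rewrite -natr1 (@le_trans _ _ n%:R) ?lerDl//.
near: n; exact: nbhs_infty_ger.
Unshelve. all: by end_near. Qed.

End Final.

(** * Averaging over the random indices *)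

Section Assembly.
Variable R : realType.
Local Notation D := (net_radius R).
Local Notation c := (spread_const R).

Lemma gauss_exp_ge0 k (F : (nat -> R) -> \bar R) :
  (forall g, 0 <= F g)%E -> (0 <= gauss_exp k F)%E.
Proof.
move=> F0; apply: (@le_trans _ _ (gauss_exp k (EFin \o fun=> 0))).
  by rewrite (has_gexpE _ _ _ _ (has_gexp_cst R k 0)).
by apply: le_gauss_exp => g /=; exact: F0.
Qed.

Lemma spread0 n (X : 'M[R]_(n, 0)) (m r : R) : spread (colspan X) m r.
Proof.
move=> _ [a _ <-] S _; rewrite (flatmx0 a) mulmx0 /vnorm /restr_norm.
by rewrite big1 ?sqrtr0 ?mulr0 ?sqrtr_ge0// => i _; rewrite mxE expr0n.
Qed.

Lemma prob_spread_ge (n d : nat) (E : {ffun 'I_n -> 'I_n} -> R) (r : R) :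
  (forall gam, (E gam)%:E <= gauss_exp (n * d) (fun g =>
     (\1_[set g' | spread (colspan (resample (gmat n d g') gam)) (c * n%:R) c] g)%:E))%E ->
  r * (n ^ n)%:R <= \sum_gam E gam ->
  (r%:E <= prob_spread n d c)%E.
Proof.
move=> HE Hr.
have nn0 : 0 < (n ^ n)%:R :> R by rewrite ltr0n expn_gt0; case: (n).
apply: (@le_trans _ _ ((n ^ n)%:R^-1%:E * \sum_(gam : {ffun 'I_n -> 'I_n}) (E gam)%:E)%E).
  by rewrite sumEFin -EFinM lee_fin mulrC ler_pdivlMr.
rewrite /prob_spread lee_wpmul2l ?lee_fin ?invr_ge0 ?(ltW nn0)//.
by apply: lee_sum => gam _; exact: HE.
Qed.

Lemma prob_spread_ge0 n d : (0 <= prob_spread n d c)%E.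
Proof.
apply: (prob_spread_ge _ _ (fun=> 0)); last by rewrite mul0r sumr_ge0.
by move=> gam; apply: gauss_exp_ge0 => g; rewrite lee_fin.
Qed.

Lemma prob_spread0 n : (1 <= prob_spread n 0 c)%E.
Proof.
apply: (prob_spread_ge _ _ (fun=> 1)).
  move=> gam; rewrite -(has_gexpE R _ _ _ (has_gexp_cst R (n * 0) 1)).
  apply: le_gauss_exp => g /=; rewrite indicE mem_set//=.
  exact: spread0.
by rewrite sumr_const card_ffun card_ord mul1r.
Qed.

Lemma prob_spread_lower (n d : nat) : (2 <= n)%N -> (0 < d)%N ->
  (D + 2) * d%:R * (2 * (2 * ln n%:R)) <= n%:R -> (D + 2) * d%:R <= n%:R ->
  ((1 - (expR (- n%:R / (2 * (2 * ln n%:R))) + expR (- n%:R) +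
     (n%:R * expR (expR 1) * expR (- (2 * ln n%:R)) + 4^-1 ^+ n)))%:E
   <= prob_spread n d c)%E.
Proof.
move=> n2 d0 dL dn.
set L := 2 * ln n%:R in dL *.
have L0 : 0 < L by rewrite mulr_gt0// ln_gt0// ltr1n.
set del := _ + expR (- n%:R); set bet := _ + 4^-1 ^+ n.
have del0 : 0 <= del by rewrite addr_ge0 ?expR_ge0.
pose b1 (gam : {ffun 'I_n -> 'I_n}) := ~~ [forall i, (multiplicity n gam i)%:R <= L].
pose b2 (gam : {ffun 'I_n -> 'I_n}) := #|gam @: [set: 'I_n]%SET|%:R < n%:R / 8 :> R.
apply: (prob_spread_ge _ _ (fun gam => if b1 gam || b2 gam then 0 else 1 - del)).
  move=> gam; case: ifPn => [_|]; first by apply: gauss_exp_ge0 => g; rewrite lee_fin.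
  rewrite negb_or /b1 negbK /b2 -leNgt => /andP[/forallP multL im8].
  exact: gauss_exp_spread.
(* As [del >= 0], subtracting both indicators stays below the case distinction and makes the sum
   linear. *)
apply: (@le_trans _ _ (\sum_(gam : {ffun 'I_n -> 'I_n}) (1 - del - (b1 gam)%:R - (b2 gam)%:R))).
  have sumC (x : R) : \sum_(gam : {ffun 'I_n -> 'I_n}) x = (n ^ n)%:R * x.
    by rewrite sumr_const card_ffun card_ord mulr_natl.
  rewrite !big_split/= !sumC !sumrN.
  have H1 : \sum_gam (b1 gam)%:R <= (n ^ n)%:R * (n%:R * expR (expR 1) * expR (- L)) :> R.
    exact: card_mult_gt.
  have H2 : \sum_gam (b2 gam)%:R <= (n ^ n)%:R * 4^-1 ^+ n :> R by exact: card_small_imset.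
  move: H1 H2; rewrite /bet; move: (\sum_gam _) (\sum_gam _) => s1 s2.
  move: (del) (n%:R * _ * _) (4^-1 ^+ n) ((n ^ n)%:R : R) => u a b N H1 H2.
  rewrite (_ : (1 - (u + (a + b))) * N = N - N * u - N * a - N * b); last by ring.
  by lra.
apply: ler_sum => gam _.
by case: (b1 gam); case: (b2 gam) => /=; lra.
Qed.

End Assembly.

Theorem mainTheorem16 (R : realType) :
  exists (C c : R), 0 < C /\ 0 < c /\
  exists p : nat -> R,
    (forall n, 0 <= p n <= 1) /\ (p n @[n --> \oo] --> 0) /\
    forall n d : nat, C * d%:R * ln (2 * d%:R) <= n%:R ->
      ((1 - p n)%:E <= prob_spread n d c)%E.
Proof.
(* The factor 4 comes from [2 L = 4 ln n]. *)
pose B : R := 4 * (net_radius R + 2).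
have B1 : 8 <= B.
  by have := expR_gt0 (128 : R); rewrite /B /net_radius; lra.
exists (32 * B ^+ 2), (spread_const R); split; first by rewrite mulr_gt0 ?exprn_gt0; lra.
split; first by rewrite divr_gt0 ?expR_gt0.
have f2 : 2 <= fail_const R.
  by rewrite /fail_const; have := expR_gt0 (expR 1 : R); lra.
exists (fun n => Num.min 1 (fail_const R / Num.sqrt n.+1%:R)); split.
  move=> n; rewrite le_min ler01 divr_ge0 ?sqrtr_ge0//=; last by lra.
  by rewrite ge_min lexx.
split; first exact: fail_cvg.
move=> n d Cn.
have [->|d0] := posnP d.
  apply: le_trans (prob_spread0 _ _); rewrite lee_fin lerBlDr lerDl.
  by rewrite le_min ler01 divr_ge0 ?sqrtr_ge0//; lra.
(* If the minimum is 1, nonnegativity suffices. Otherwise [n >= 2], because [fail_const >= 2] while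
   [sqrt (n + 1) <= 2] for [n <= 1]. *)
have [f1|f1] := leP 1 (fail_const R / Num.sqrt n.+1%:R).
  rewrite subrr; exact: prob_spread_ge0.
have n2 : (2 <= n)%N.
  rewrite ltnNge; apply/negP => n1; move: f1; apply/negP; rewrite -leNgt.
  rewrite ler_pdivlMr ?sqrtr_gt0// mul1r (le_trans _ f2)//.
  rewrite -[leRHS]ger0_norm// -sqrtr_sqr ler_wsqrtr//.
  rewrite (@le_trans _ _ 2)//; first by rewrite (ler_nat _ _ 2).
  by lra.
have [|Bn1 Bn2] := dim_mul_ln_le R B n d _ d0 (ltnW n2) Cn; first by lra.
apply: le_trans (prob_spread_lower _ _ _ n2 d0 _ _).
- by rewrite lee_fin lerD2l lerN2 fail_prob_le.
- apply: le_trans Bn1; rewrite /B le_eqVlt; apply/orP; left; apply/eqP; ring.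
- apply: le_trans Bn2; rewrite ler_wpM2r// /B.
  by have := expR_gt0 (128 : R); rewrite /net_radius; lra.
Qed.
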